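(* Let $\mu\ge 2$ and $\lambda\ge 1$ be integers and let $\epsilon\ge\log_\mu 2$ be real. Let $N$ be a positive integer with $$\log_2 N\ \ge\ 4\mu^{2+\epsilon}+\Big(1+\frac{1}{\epsilon}\Big)\lambda .$$ Then for every positive integer $m$ and every $\mu$-linear polynomial $f\in\mathbb{Z}[X_1,\dots,X_\mu]$ co-prime to $N$, $$\Pr_{\mathbf{x}\leftarrow\{0,\dots,m-1\}^\mu}\big[f(\mathbf{x})\equiv 0\pmod N\big]\le 2^{-\lambda}+\frac{\mu}{m},$$ where $\mathbf{x}$ is uniform on $\{0,\dots,m-1\}^\mu$.
   Context: A polynomial $f\in\mathbb{Z}[X_1,\dots,X_\mu]$ is $\mu$-linear (multilinear) if it has degree at most $1$ in each variable. $f$ is co-prime to $N$ if the greatest common divisor of $N$ and all coefficients of $f$ equals $1$. *)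

(* Defs.v *)
From Stdlib Require Import Reals.
From HB Require Import structures.
From mathcomp Require Import all_boot all_order all_algebra.
From mathcomp Require Import mpoly.
Set Implicit Arguments. Unset Strict Implicit. Unset Printing Implicit Defensive.
Import Order.TTheory GRing.Theory Num.Theory.

Local Open Scope ring_scope.

Definition multilinear (mu : nat) (f : {mpoly int[mu]}) : Prop :=
  forall mon : 'X_{1..mu}, mon \in msupp f -> forall i : 'I_mu, (mon i <= 1)%N.

Definition coprime_to (mu : nat) (f : {mpoly int[mu]}) (N : nat) : Prop :=
  forall d : nat, (d %| N)%N ->
    (forall mon : 'X_{1..mu}, (d%:Z %| f@_mon)%Z) -> d = 1%N.

Definition eval_at (mu m : nat) (f : {mpoly int[mu]}) (x : {ffun 'I_mu -> 'I_m}) : int :=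
  f.@[fun i => (nat_of_ord (x i))%:Z].

Definition num_zeros (mu m N : nat) (f : {mpoly int[mu]}) : nat :=
  #|[set x : {ffun 'I_mu -> 'I_m} | (N%:Z %| eval_at f x)%Z]|.

Local Close Scope ring_scope.
Local Open Scope R_scope.

Definition zero_prob (mu m N : nat) (f : {mpoly int[mu]}) : R :=
  INR (num_zeros m N f) / INR (m ^ mu)%N.

Definition logb (b x : R) : R := ln x / ln b.

(* Main.v *)
(* Fix the variables one at a time, dividing by the content of the partial
   evaluation after each step; f(x) = 0 mod N means that the contents found
   along the way have a product divisible by N.  The values of a variable for
   which D | N divides the new content lie in one residue class mod D, so there
   are at most m / D + 1 of them: up to an error 1 / m, the p-adic valuation of
   the content behaves like a geometric variable of parameter 1 / p,
   independently over p.  The error stays 1 / m whatever the number of divisors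
   involved, because the averaged function is a nonnegative combination, of
   total weight 1, of the indicators of D | content.  Hence the probability is
   at most mu / m plus the product over p^r || N of the tails P_p that a sum of
   mu such variables is at least r.

   Let th = eps / (1 + eps).  If p >= mu^(1 + eps), the union bound
   P_p <= (mu / p)^r gives P_p <= p^(- th r).  For the fewer than mu^(1 + eps)
   smaller primes, the Chernoff bound at p^th gives
   P_p <= p^(- th r) ((1 - 1/p) / (1 - p^(th - 1)))^mu, and the product of these
   losses is at most 2^(4 th mu^(2 + eps)).  So the product of the tails is at
   most N^(- th) 2^(4 th mu^(2 + eps)) <= 2^(- lambda). *)

Require Import Defs.
From Stdlib Require Import Reals.
From HB Require Import structures.
From mathcomp Require Import all_boot all_order all_algebra.
From mathcomp Require Import mpoly.
From mathcomp Require Import Rstruct.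
From Stdlib Require Import Lra.
Import Order.TTheory GRing.Theory Num.Theory.

Set Implicit Arguments. Unset Strict Implicit. Unset Printing Implicit Defensive.

Local Open Scope ring_scope.

(** * Tails of sums of geometric variables *)

(* [nb_tail x k r] is the probability that a sum of [k] independent geometric
   variables, each at least [j] with probability [x ^ j], is at least [r]; the
   recursion conditions on whether the last variable is [0]. *)
Fixpoint nb_tail (F : realFieldType) (x : F) (k : nat) : nat -> F :=
  match k with
  | 0 => fun r => (r == 0%N)%:R
  | k'.+1 => fix tail r := match r with
    | 0 => 1
    | r'.+1 => (1 - x) * nb_tail x k' r'.+1 + x * tail r'
    end
  end.

Lemma nb_tail0 (F : realFieldType) (x : F) (k : nat) : nb_tail x k 0 = 1.
Proof. by case: k. Qed.

Lemma nb_tailSS (F : realFieldType) (x : F) (k r : nat) :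
  nb_tail x k.+1 r.+1 = (1 - x) * nb_tail x k r.+1 + x * nb_tail x k.+1 r.
Proof. by []. Qed.

Lemma nb_tail_ge0 (F : realFieldType) (x : F) (k r : nat) :
  0 <= x <= 1 -> 0 <= nb_tail x k r.
Proof.
case/andP=> x0 x1; elim: k r => [|k IHk] r; first exact: ler0n.
elim: r => [|r IHr]; first exact: ler01.
by rewrite nb_tailSS addr_ge0 // mulr_ge0 // subr_ge0.
Qed.

Lemma nb_tail_noninc (F : realFieldType) (x : F) (k r : nat) :
  0 <= x <= 1 -> nb_tail x k r.+1 <= nb_tail x k r.
Proof.
case/andP=> x0 x1; have x1' : 0 <= 1 - x by rewrite subr_ge0.
elim: k r => [|k IHk] r; first by case: r => //=; rewrite ler01.
elim: r => [|r IHr].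
  rewrite nb_tailSS nb_tail0 mulr1 -lerBrDr.
  by rewrite ler_piMr // -(nb_tail0 x k).
by rewrite nb_tailSS [leRHS]nb_tailSS lerD // ler_wpM2l.
Qed.

(** Reaching [r] forces the variables to dominate one of the at most [k ^ r] compositions of [r]
    into [k] parts, zeros allowed, each with probability [x ^ r]. *)
Lemma nb_tail_union (F : realFieldType) (x : F) (k r : nat) :
  0 <= x <= 1 -> nb_tail x k r <= (k%:R * x) ^+ r.
Proof.
case/andP=> x0 x1; have x1' : 0 <= 1 - x by rewrite subr_ge0.
elim: k r => [|k IHk] r; first by rewrite mul0r expr0n.
elim: r => [|r IHr]; first by rewrite expr0.
rewrite nb_tailSS.
have kx0 : 0 <= k%:R * x by rewrite mulr_ge0.
apply: (@le_trans _ _ ((k%:R * x) * (k.+1%:R * x) ^+ r + x * (k.+1%:R * x) ^+ r)).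
  apply: lerD; last exact: ler_wpM2l.
  apply: le_trans (_ : nb_tail x k r.+1 <= _).
    by rewrite ler_piMl ?nb_tail_ge0 ?x0 // gerBl.
  apply: le_trans (IHk _) _; rewrite exprS ler_wpM2l //.
  by rewrite lerXn2r ?nnegrE // ?mulr_ge0 // ler_wpM2r // ler_nat.
have e : k.+1%:R * x = k%:R * x + x by rewrite -natr1 mulrDl mul1r.
by rewrite -mulrDl exprS {2}e.
Qed.

(** Markov's inequality for [z] to the power of the sum: the ratio is the generating function of one
    geometric variable at [z]. *)
Lemma nb_tail_chernoff (F : realFieldType) (x z : F) (k r : nat) :
  0 <= x <= 1 -> 1 <= z -> x * z < 1 ->
  z ^+ r * nb_tail x k r <= ((1 - x) / (1 - x * z)) ^+ k.
Proof.
case/andP=> x0 x1 z1 xz1.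
have d0 : 0 < 1 - x * z by rewrite subr_gt0.
have x1' : 0 <= 1 - x by rewrite subr_ge0.
have z0 : 0 <= z by apply: le_trans z1.
set rho := _ / _.
have rho1 : 1 <= rho by rewrite ler_pdivlMr // mul1r lerB // ler_peMr.
have key : 1 - x = rho * (1 - x * z) by rewrite divfK // gt_eqF.
elim: k r => [|k IHk] r.
  by case: r => [|r] /=; rewrite ?mulr0 ?expr0 ?mulr1.
elim: r => [|r IHr]; first by rewrite expr0 mul1r exprn_ege1.
rewrite nb_tailSS mulrDr mulrCA.
have -> : rho ^+ k.+1 = (1 - x) * rho ^+ k + (x * z) * rho ^+ k.+1.
  have -> : (1 - x) * rho ^+ k = (1 - x * z) * rho ^+ k.+1.
    by rewrite key exprS mulrA [rho * _]mulrC.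
  by rewrite -mulrDl subrK mul1r.
apply: lerD; first exact: ler_wpM2l.
have -> : z ^+ r.+1 * (x * nb_tail x k.+1 r) =
  (x * z) * (z ^+ r * nb_tail x k.+1 r) 
    by rewrite exprS mulrCA -!mulrA; congr (_ * _); rewrite mulrCA.
by rewrite ler_wpM2l // mulr_ge0.
Qed.

(* The increments of [j |-> nb_tail x k (r - j)]: they let a truncated tail be
   averaged against an arbitrary distribution of [j] by summation by parts. *)
Definition nb_incr (F : realFieldType) (x : F) (k r j : nat) : F :=
  if j is j'.+1 then nb_tail x k (r - j'.+1) - nb_tail x k (r - j')
  else nb_tail x k r.

Lemma nb_incr_ge0 (F : realFieldType) (x : F) (k r j : nat) :
  0 <= x <= 1 -> 0 <= nb_incr x k r j.
Proof.
move=> x01; case: j => [|j] /=; first exact: nb_tail_ge0.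
rewrite subr_ge0 subnS; case: (r - j)%N => [|s] //=.
exact: nb_tail_noninc.
Qed.

Lemma sum_nb_incr (F : realFieldType) (x : F) (k r v : nat) :
  \sum_(0 <= j < v.+1) nb_incr x k r j = nb_tail x k (r - v).
Proof.
elim: v => [|v IHv]; first by rewrite big_nat1 subn0.
by rewrite big_nat_recr //= IHv addrC subrK.
Qed.

(** By summation by parts, the left side averages [nb_tail x k (r - X)] over a geometric [X], which
    adds one variable to the sum. Increments past [r] vanish, so any [n > r] will do. *)
Lemma sum_nb_incr_geom (F : realFieldType) (x : F) (k r n : nat) : (r < n)%N ->
  \sum_(0 <= j < n) nb_incr x k r j * x ^+ j = nb_tail x k.+1 r.
Proof.
elim: r n => [|r IHr] [|n] // ltrn.
  rewrite big_nat_recl //= expr0 mulr1 nb_tail0 big1 ?addr0 // => j _.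
  by rewrite subrr mul0r.
case: n ltrn => // n ltrn.
rewrite nb_tailSS -(IHr n.+1) // !big_nat_recl //= subn0 subSS subn0 mulrDr.
rewrite expr0 expr1 !mulr1.
under eq_bigr => j _ do rewrite !subSS exprS mulrCA.
by rewrite -mulr_sumr [_ * x]mulrC mulrBr mulrBl mul1r !addrA [_ + _ - _]addrAC.
Qed.

(* [v b p] is the [p]-adic valuation of the content obtained for the value [b]
   of the variable being fixed. *)
Lemma sum_prod_nb_tail (F : realFieldType) (n M : nat) (T : finType)
    (x : 'I_M -> F) (r : 'I_M -> nat) (v : T -> 'I_M -> nat) (m : F) :
  (forall p, 0 <= x p <= 1) -> (forall p, (r p < M)%N) ->
  (forall b p, (v b p <= r p)%N) ->
  (forall J : {ffun 'I_M -> 'I_M},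
    #|[set b | [forall p, (J p <= v b p)%N]]|%:R
      <= m * (\prod_p x p ^+ J p) + 1) ->
  \sum_b \prod_p nb_tail (x p) n (r p - v b p)
    <= m * (\prod_p nb_tail (x p) n.+1 (r p)) + 1.
Proof.
move=> x01 rM vr cnt.
pose w p (j : 'I_M) := nb_incr (x p) n (r p) j.
(* Each tail is the sum of [w p j] over [j <= v b p]; distributing the product over [p] leaves, for
   each [J], a weight times a count of values [b]. *)
have -> : \sum_b \prod_p nb_tail (x p) n (r p - v b p) =
    \sum_(J : {ffun 'I_M -> 'I_M}) (\prod_p w p (J p)) *
      #|[set b | [forall p, (J p <= v b p)%N]]|%:R.
  transitivity (\sum_b \sum_(J : {ffun 'I_M -> 'I_M})
      (\prod_p w p (J p)) * [forall p, (J p <= v b p)%N]%:R).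
    apply: eq_bigr => b _.
    transitivity (\prod_p \sum_(j : 'I_M) w p j * (j <= v b p)%N%:R).
      apply: eq_bigr => p _; rewrite -sum_nb_incr.
      rewrite (big_nat_widen _ _ M) ?(leq_ltn_trans (vr b p)) //.
      rewrite big_mkord big_mkcond /=; apply: eq_bigr => j _.
      by rewrite ltnS; case: leqP; rewrite ?mulr1 ?mulr0.
    rewrite bigA_distr_bigA; apply: eq_bigr => J _.
    rewrite big_split /=; congr (_ * _).
    rewrite -natr_prod; congr (_%:R); rewrite -[RHS]/(nat_of_bool _).
    case: forallP => [h|h]; first by rewrite big1 // => p _; rewrite h.
    have /existsP[p hp] : [exists p, ~~ (J p <= v b p)%N].
      by rewrite -negb_forall; apply/forallP.
    by rewrite (bigD1 p) //= (negbTE hp).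
  rewrite exchange_big /=; apply: eq_bigr => J _.
  rewrite -mulr_sumr -natr_sum; congr (_ * _%:R).
  by rewrite -sum1dep_card [RHS]big_mkcond; apply: eq_bigr => b _; case: ifP.
have w0 J : 0 <= \prod_p w p (J p).
  by apply: prodr_ge0 => p _; apply: nb_incr_ge0.
apply: (@le_trans _ _ (\sum_(J : {ffun 'I_M -> 'I_M})
    (\prod_p w p (J p)) * (m * (\prod_p x p ^+ J p) + 1))).
  by apply: ler_sum => J _; apply: ler_wpM2l.
rewrite (eq_bigr (fun J : {ffun 'I_M -> 'I_M} =>
    m * (\prod_p (w p (J p) * x p ^+ J p)) + \prod_p w p (J p))); last first.
  by move=> J _; rewrite mulrDr mulr1 mulrCA -big_split.
rewrite big_split -mulr_sumr.
rewrite -(bigA_distr_bigA (fun p (j : 'I_M) => w p j * x p ^+ j)).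
rewrite -(bigA_distr_bigA w).
rewrite le_eqVlt; apply/orP; left; apply/eqP; congr (_ * _ + _).
  by apply: eq_bigr => p _; rewrite -(sum_nb_incr_geom _ _ (rM p)) big_mkord.
(* The weights of all [J] add up to [1]: for each [p] the increments telescope to a tail at [0].
   This keeps the additive error at [1]. *)
rewrite big1 // => p _.
rewrite -(big_mkord predT (fun j => nb_incr (x p) n (r p) j)).
have tot K : (r p < K)%N -> \sum_(0 <= j < K) nb_incr (x p) n (r p) j = 1.
  case: K => // K rK; rewrite sum_nb_incr.
  by rewrite (eqP (_ : r p - K == 0)%N) ?nb_tail0 // subn_eq0 -ltnS.
exact: tot.
Qed.

(** * Zeros of multilinear polynomials modulo [N] *)

Definition fcons (T : Type) (n : nat) (t : T) (y : {ffun 'I_n -> T}) :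
    {ffun 'I_n.+1 -> T} :=
  [ffun i => if unlift ord0 i is Some j then y j else t].

Lemma fcons0 (T : Type) (n : nat) (t : T) (y : {ffun 'I_n -> T}) :
  fcons t y ord0 = t.
Proof. by rewrite ffunE unlift_none. Qed.

Lemma fcons_lift (T : Type) (n : nat) (t : T) (y : {ffun 'I_n -> T}) (i : 'I_n) :
  fcons t y (lift ord0 i) = y i.
Proof. by rewrite ffunE liftK. Qed.

Lemma big_fcons (R : Type) (idx : R) (op : Monoid.com_law idx) (T : finType)
    (n : nat) (F : {ffun 'I_n.+1 -> T} -> R) :
  \big[op/idx]_x F x = \big[op/idx]_t \big[op/idx]_y F (fcons t y).
Proof.
rewrite pair_big /=.
rewrite (reindex (fun u : T * {ffun 'I_n -> T} => fcons u.1 u.2)) //=.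
exists (fun x : {ffun 'I_n.+1 -> T} => (x ord0, [ffun i => x (lift ord0 i)])).
  move=> [t y] _ /=; rewrite fcons0; congr (_, _).
  by apply/ffunP => i; rewrite ffunE fcons_lift.
move=> x _; apply/ffunP => i /=.
by case: (unliftP ord0 i) => [j|] ->; rewrite ?fcons_lift ?fcons0 ?ffunE.
Qed.

(* A multilinear polynomial is its coefficient function on exponent vectors
   [J : {ffun 'I_n -> bool}]. *)
Definition mleval (n : nat) (c : {ffun 'I_n -> bool} -> int) (x : 'I_n -> int) : int :=
  \sum_J c J * \prod_i x i ^+ J i.

(** The coefficients, in the remaining variables, after the first variable is set to [b]. *)
Definition mlfix (n : nat) (c : {ffun 'I_n.+1 -> bool} -> int) (b : int)
    (J : {ffun 'I_n -> bool}) : int :=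
  c (fcons false J) + b * c (fcons true J).

Definition mlcoprime (n : nat) (c : {ffun 'I_n -> bool} -> int) (N : nat) : Prop :=
  forall d : nat, (d %| N)%N -> (forall J, (d%:Z %| c J)%Z) -> d = 1%N.

Definition mlzeros (n m N : nat) (c : {ffun 'I_n -> bool} -> int) : nat :=
  (\sum_(x : {ffun 'I_n -> 'I_m}) (N%:Z %| mleval c (fun i => (x i)%:Z))%Z)%N.

(** Taking the gcd with [N] gives a positive divisor of [N] even if all coefficients vanish. *)
Definition mlcontent (n : nat) (c : {ffun 'I_n -> bool} -> int) (N : nat) : nat :=
  gcdn N (\big[gcdn/0%N]_J `|c J|%N).

Lemma mleval_fcons (n m : nat) (c : {ffun 'I_n.+1 -> bool} -> int) (b : 'I_m)
    (y : {ffun 'I_n -> 'I_m}) :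
  mleval c (fun i => (fcons b y i)%:Z) = mleval (mlfix c b%:Z) (fun i => (y i)%:Z).
Proof.
rewrite /mleval big_fcons exchange_big /=; apply: eq_bigr => J _.
rewrite big_bool /= !big_ord_recl !fcons0 expr1 expr0 mul1r.
have e t : \prod_(i < n) (fcons b y (lift ord0 i))%:Z ^+ fcons t J (lift ord0 i) =
    \prod_(i < n) (y i)%:Z ^+ J i.
  by apply: eq_bigr => i _; rewrite !fcons_lift.
by rewrite !e mulrA -mulrDl addrC [_ * b%:Z]mulrC.
Qed.

Lemma mlzerosS (n m N : nat) (c : {ffun 'I_n.+1 -> bool} -> int) :
  mlzeros m N c = (\sum_(b < m) mlzeros m N (mlfix c b%:Z))%N.
Proof.
rewrite /mlzeros big_fcons; apply: eq_bigr => b _.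
by apply: eq_bigr => y _; rewrite mleval_fcons.
Qed.

Lemma mleval_scale (n : nat) (g : int) (c : {ffun 'I_n -> bool} -> int)
    (x : 'I_n -> int) :
  mleval (fun J => g * c J) x = g * mleval c x.
Proof. by rewrite /mleval mulr_sumr; apply: eq_bigr => J _; rewrite mulrA. Qed.

Lemma dvdn_mlcontent (n d N : nat) (c : {ffun 'I_n -> bool} -> int) :
  (d %| mlcontent c N)%N <-> (d %| N)%N /\ forall J, (d%:Z %| c J)%Z.
Proof.
rewrite /mlcontent dvdn_gcd; split=> [/andP[-> /dvdn_biggcdP dc]|[-> dc]].
  by split=> // J; rewrite dvdzE dc.
by apply/dvdn_biggcdP => J _; have := dc J; rewrite dvdzE.
Qed.

Lemma mlcontent_gt0 (n N : nat) (c : {ffun 'I_n -> bool} -> int) :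
  (0 < N)%N -> (0 < mlcontent c N)%N.
Proof.
move=> N0; have /dvdn_mlcontent[gN _] := dvdnn (mlcontent c N).
exact: dvdn_gt0 gN.
Qed.

(** Divide the coefficients and [N] by the content [g]: a common factor [d] of the quotients would
    make [d * g] divide [g]. *)
Lemma mlzeros_content (n m N : nat) (c : {ffun 'I_n -> bool} -> int) : (0 < N)%N ->
  exists2 c' : {ffun 'I_n -> bool} -> int,
    mlcoprime c' (N %/ mlcontent c N) &
    mlzeros m N c = mlzeros m (N %/ mlcontent c N) c'.
Proof.
move=> N0; set g := mlcontent c N.
have g0 : (0 < g)%N by apply: mlcontent_gt0.
have /dvdn_mlcontent[gN gc] := dvdnn g.
pose c' J := (c J %/ g%:Z)%Z.
have cE J : c J = g%:Z * c' J by rewrite mulrC divzK.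
exists c'.
  move=> d dN dc.
  have /dvdn_mlcontent : (d * g %| N)%N /\ forall J, ((d * g)%N%:Z %| c J)%Z.
    split=> [|J]; first by rewrite -(divnK gN) dvdn_pmul2r.
    by rewrite cE PoszM [d%:Z * _]mulrC dvdz_mul2l ?dc // eqz_nat -lt0n.
  rewrite -/g -[X in (_ %| X)%N]mul1n dvdn_pmul2r // dvdn1.
  by move/eqP.
apply: eq_bigr => x _; congr (nat_of_bool _).
have -> : mleval c (fun i => (x i)%:Z) = g%:Z * mleval c' (fun i => (x i)%:Z).
  by rewrite -mleval_scale; apply: eq_bigr => J _; rewrite -cE.
by rewrite -{1}(divnK gN) PoszM [_%:Z * g%:Z]mulrC dvdz_mul2l // eqz_nat -lt0n.
Qed.

(* If [D] divides both [g + b h] and [g + b' h], it divides [(b - b') h], while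
   [D] is coprime to the coefficients of [h]: a common factor would divide [g]. *)
Lemma mlfix_content_mod (n D N : nat) (c : {ffun 'I_n.+1 -> bool} -> int) (b b' : int) :
  mlcoprime c N -> (D %| mlcontent (mlfix c b) N)%N ->
  (D %| mlcontent (mlfix c b') N)%N -> (D%:Z %| b - b')%Z.
Proof.
move=> cop /dvdn_mlcontent[DN Db] /dvdn_mlcontent[_ Db'].
pose h J := c (fcons true J).
have [DmD Dh] := (dvdn_mlcontent (mlcontent h D) D h).1 (dvdnn _).
have h1 : mlcontent h D = 1%N.
  apply: cop; first exact: dvdn_trans DmD DN.
  have Dg J : ((mlcontent h D)%:Z %| c (fcons false J))%Z.
    have -> : c (fcons false J) = mlfix c b J - b * h J by rewrite /mlfix addrK.
    apply: rpredB; last by rewrite dvdz_mull.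
    by apply: dvdz_trans (Db J); rewrite dvdzE.
  move=> J; pose J' : {ffun 'I_n -> bool} := [ffun i => J (lift ord0 i)].
  have -> : J = fcons (J ord0) J'.
    apply/ffunP => i; case: (unliftP ord0 i) => [j|] ->.
      by rewrite fcons_lift ffunE.
    by rewrite fcons0.
  by case: (J ord0); [apply: Dh | apply: Dg].
(* [D] divides [(b - b') * D] and every [(b - b') * h J], hence also [b - b'] times their gcd
   factor, which is [1]. *)
have : (D %| `|(b - b')%R| * mlcontent h D)%N.
  rewrite /mlcontent muln_gcdr dvdn_gcd dvdn_mull //=.
  apply: (big_ind (fun z => D %| `|(b - b')%R| * z)%N).
  - by rewrite muln0.
  - by move=> u v Du Dv; rewrite muln_gcdr dvdn_gcd Du.
  move=> J _; rewrite -abszM -[D]/(`|D%:Z|%N) -dvdzE.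
  have -> : (b - b') * h J = mlfix c b J - mlfix c b' J 
    by rewrite /mlfix mulrBl opprD addrACA subrr add0r.
  by rewrite rpredB.
by rewrite h1 muln1 dvdzE.
Qed.

(** Within one residue class the quotient by [D] is injective, and it takes at most [m %/ D + 1]
    values. *)
Lemma card_congruent_le (m D : nat) (A : {set 'I_m}) : (0 < D)%N ->
  (forall a b, a \in A -> b \in A -> (D%:Z %| (a : nat)%:Z - (b : nat)%:Z)%Z) ->
  (#|A| <= m %/ D + 1)%N.
Proof.
move=> D0 AD.
have mD (a : 'I_m) : (a %/ D < m %/ D + 1)%N.
  by rewrite addn1 ltnS leq_div2r // ltnW.
pose q a := Ordinal (mD a).
rewrite -[X in (_ <= X)%N]card_ord -(card_in_imset (f := q)) ?max_card //.
move=> a b aA bA /(congr1 val) /= qab.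
have := AD a b aA bA; rewrite -eqz_mod_dvd !modz_nat => /eqP[rab].
by apply: val_inj; rewrite /= (divn_eq a D) (divn_eq b D) qab rab.
Qed.

(* The factor of a non-prime [p] is [1], as then [logn p N = 0]. *)
Definition nb_bound (F : realFieldType) (M n N : nat) : F :=
  \prod_(p < M) nb_tail (p : nat)%:R^-1 n (logn p N).

Lemma natr_inv_itv (F : realFieldType) (p : nat) : 0 <= (p%:R^-1 : F) <= 1.
Proof.
(* The index [p = 0] occurs in the products; its inverse is [0] by convention. *)
rewrite invr_ge0 ler0n /=; case: p => [|p]; first by rewrite invr0.
by rewrite invf_le1 ?ltr0n // ler1n.
Qed.

Lemma prod_logn (M N : nat) : (0 < N < M)%N -> (\prod_(p < M) p ^ logn p N)%N = N.
Proof.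
case/andP=> N0 NM.
rewrite -[RHS]partnT // /partn.
rewrite (big_nat_widen _ _ M) // big_mkord big_mkcond [RHS]big_mkcond /=.
apply: eq_bigr => p _; rewrite ltnS; case: leqP => // Np.
by rewrite ltn_log0.
Qed.

(** Induction on the number of variables, slicing by the value of the first; each averaging adds
    [1 / m]. [M] stays fixed while the modulus shrinks, so all products share one range. *)
Lemma mlzeros_le (F : realFieldType) (m M n N : nat) (c : {ffun 'I_n -> bool} -> int) :
  (0 < m)%N -> (0 < N < M)%N -> mlcoprime c N ->
  (mlzeros m N c)%:R <= (m ^ n)%:R * (nb_bound F M n N + n%:R / m%:R).
Proof.
move=> m0; elim: n N c => [|n IHn] N c /andP[N0 NM] cop.
  rewrite mul0r addr0 mul1r /mlzeros.
  have e0 (T : finType) (x y : {ffun 'I_0 -> T}) : x = y by apply/ffunP => -[].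
  have b0 : 0 <= nb_bound F M 0 N.
    by apply: prodr_ge0 => p _; apply: nb_tail_ge0; apply: natr_inv_itv.
  pose J0 : {ffun 'I_0 -> bool} := [ffun => false].
  have evE (x : 'I_0 -> int) : mleval c x = c J0.
    rewrite /mleval (bigD1 J0) //= big_ord0 mulr1 big_pred0 ?addr0 // => J.
    by rewrite (e0 _ J J0) eqxx.
  have -> : (\sum_(x : {ffun 'I_0 -> 'I_m})
      (N%:Z %| mleval c (fun i => (x i)%:Z))%Z = (N%:Z %| c J0)%Z)%N.
    under eq_bigr => x _ do rewrite evE.
    by rewrite sum_nat_const card_ffun !card_ord mul1n.
  (* A constant divisible by [N] and coprime to it forces [N = 1], where the bound is [1]. *)
  case: (boolP (N%:Z %| c J0)%Z) => [Nc|_]; last exact: b0.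
  have N1 : N = 1%N by apply: cop => // J; rewrite (e0 _ J J0).
  by rewrite /nb_bound big1 ?lexx // => p _; rewrite N1 logn1 nb_tail0.
pose g (b : 'I_m) := mlcontent (mlfix c b%:Z) N.
have gN b : (g b %| N)%N.
  by have [] := (dvdn_mlcontent (g b) N (mlfix c b%:Z)).1 (dvdnn _).
have g0 b : (0 < g b)%N by apply: mlcontent_gt0.
have gM b : (g b < M)%N by apply: leq_ltn_trans NM; apply: dvdn_leq.
have mn0 : (0 : F) <= (m ^ n)%:R by [].
have mF : (m%:R : F) != 0 by rewrite pnatr_eq0 -lt0n.
rewrite mlzerosS natr_sum.
have step (b : 'I_m) : (mlzeros m N (mlfix c b%:Z))%:R <=
    (m ^ n)%:R * (nb_bound F M n (N %/ g b) + n%:R / m%:R).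
  have [c' cop' ->] := mlzeros_content m (mlfix c (b : nat)%:Z) N0.
  apply: IHn cop'; rewrite (leq_ltn_trans (leq_div _ _) NM) andbT.
  by rewrite divn_gt0 ?mlcontent_gt0 // dvdn_leq // gN.
apply: le_trans (ler_sum _ (fun b _ => step b)) _.
rewrite -mulr_sumr big_split /= sumr_const card_ord expnSr natrM -!mulrA.
apply: ler_wpM2l => //.
have -> : (n%:R / m%:R : F) *+ m = n%:R by rewrite -[_ *+ m]mulr_natr divfK.
have -> : m%:R * (nb_bound F M n.+1 N + n.+1%:R / m%:R) =
   (m%:R * nb_bound F M n.+1 N + 1) + n%:R.
  by rewrite mulrDr mulrCA divff // mulr1 -natr1 addrAC addrA.
rewrite lerD2r.
under eq_bigr => b _.
  rewrite /nb_bound; under eq_bigr => p _ do rewrite logn_div //; over.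
apply: sum_prod_nb_tail => [p|p|b p|J].
- exact: natr_inv_itv.
- by apply: leq_ltn_trans NM; apply: ltnW; apply: ltn_logl.
- by rewrite dvdn_leq_log.
set A := [set b | _].
pose D := (\prod_(p < M) p ^ J p)%N.
have AD b : b \in A -> (D %| g b)%N.
  rewrite inE => /forallP Jg.
  rewrite -(@prod_logn M (g b)) ?g0 ?gM // /D.
  apply: (big_ind2 (fun u v => u %| v)%N) => // [u1 u2 v1 v2|p _].
    exact: dvdn_mul.
  by rewrite dvdn_exp2l.
have xD : \prod_(p < M) (p%:R^-1 : F) ^+ J p = D%:R^-1.
  rewrite natr_prod -prodfV; apply: eq_bigr => p _.
  by rewrite natrX exprVn.
(* [D] is [0] if [J] is positive at [p = 0], but then [A] is empty; a member of [A] makes [D] a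
   divisor of a positive content. *)
rewrite xD; have [->|/set0Pn[b0 b0A]] := eqVneq A set0.
  by rewrite cards0 addr_ge0 // mulr_ge0 // invr_ge0.
have D0 : (0 < D)%N := dvdn_gt0 (g0 b0) (AD _ b0A).
apply: (@le_trans _ _ (m %/ D + 1)%:R).
  rewrite ler_nat; apply: card_congruent_le => // a b aA bA.
  by apply: (mlfix_content_mod cop); apply: AD.
rewrite natrD lerD2r ler_pdivlMr ?ltr0n // -natrM ler_nat.
exact: leq_divM.
Qed.

(** * From multivariate polynomials to coefficient functions *)

Definition mlcoeff (mu : nat) (f : {mpoly int[mu]}) (J : {ffun 'I_mu -> bool}) : int :=
  f@_[multinom nat_of_bool (J i) | i < mu].

Lemma meval_mlcoeff (mu : nat) (f : {mpoly int[mu]}) (x : 'I_mu -> int) :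
  multilinear f -> f.@[x] = mleval (mlcoeff f) x.
Proof.
move=> ml; rewrite mevalE /mleval.
pose mon (J : {ffun 'I_mu -> bool}) := [multinom nat_of_bool (J i) | i < mu].
pose ex (m : 'X_{1..mu}) : {ffun 'I_mu -> bool} := [ffun i => m i != 0%N].
have monK : cancel mon ex.
  by move=> J; apply/ffunP => i; rewrite ffunE mnmE eqb0 negbK.
have exK m : m \in msupp f -> mon (ex m) = m.
  move=> /ml m1; apply/mnmP => i; rewrite mnmE ffunE.
  by have := m1 i; case: (m i) => [|[]].
(* Exponent vectors outside the support contribute [0]; the others enumerate the support up to
   order. *)
rewrite (bigID (fun J => mon J \in msupp f)) /= [X in _ + X]big1 ?addr0; last first.
  by move=> J; rewrite /mlcoeff -/(mon J) => /memN_msupp_eq0 ->; rewrite mul0r.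
rewrite -[RHS]big_filter.
rewrite (perm_big
  [seq mon J | J <- index_enum {ffun 'I_mu -> bool} & mon J \in msupp f]) /=.
  rewrite big_map; apply: eq_bigr => J _.
  by congr (_ * _); apply: eq_bigr => i _; rewrite mnmE.
apply: uniq_perm => //.
  by rewrite map_inj_uniq ?filter_uniq ?index_enum_uniq //; apply: can_inj monK.
move=> m; apply/idP/mapP => [mf|[J]].
  by exists (ex m); rewrite ?mem_filter ?exK ?mf ?mem_index_enum.
by rewrite mem_filter => /andP[+ _] ->.
Qed.

Lemma mlcoprime_mlcoeff (mu N : nat) (f : {mpoly int[mu]}) :
  multilinear f -> coprime_to f N -> mlcoprime (mlcoeff f) N.
Proof.
move=> ml cop d dN dc; apply: cop dN _ => m.
case: (boolP (m \in msupp f)) => [mf|/memN_msupp_eq0 -> //].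
have -> : m = [multinom nat_of_bool ([ffun i => m i != 0%N] i) | i < mu].
  apply/mnmP => i; rewrite mnmE ffunE.
  by have := ml m mf i; case: (m i) => [|[]].
exact: dc.
Qed.

Lemma num_zeros_mlcoeff (mu m N : nat) (f : {mpoly int[mu]}) :
  multilinear f -> num_zeros m N f = mlzeros m N (mlcoeff f).
Proof.
move=> ml; rewrite /num_zeros -sum1dep_card big_mkcond; apply: eq_bigr => x _.
by rewrite /eval_at meval_mlcoeff //; case: ifP.
Qed.

Local Close Scope ring_scope.
Local Open Scope R_scope.

Lemma zero_prob_le (mu m N M : nat) (f : {mpoly int[mu]}) :
  (0 < m)%N -> (0 < N < M)%N -> multilinear f -> coprime_to f N ->
  zero_prob m N f <= nb_bound R M mu N + INR mu / INR m.
Proof.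
move=> m0 NM ml cop; apply/RleP.
rewrite /zero_prob !INRE !RdivE RplusE num_zeros_mlcoeff //.
rewrite ler_pdivrMr ?ltr0n ?expn_gt0 ?m0 // mulrC.
exact: mlzeros_le (mlcoprime_mlcoeff ml cop).
Qed.

(** * The size of the tail bound *)

Lemma Rpower_gt0 (x y : R) : 0 < Rpower x y.
Proof. exact: exp_pos. Qed.

Lemma exp_le_compat (x y : R) : x <= y -> exp x <= exp y.
Proof. by case=> [xy|->]; [left; apply: exp_increasing | right]. Qed.

(** Concavity of [ln]: average its tangent inequalities at [L], taken at [t] and [1], with weights
    [a] and [1 - a]. *)
Lemma Rpower_Bernoulli (t a : R) :
  0 < t -> 0 < a < 1 -> Rpower t a <= 1 - a + a * t.
Proof.
move=> t0 [a0 a1]; set L := 1 - a + a * t.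
have at0 : 0 < a * t by apply: Rmult_lt_0_compat.
have L0 : 0 < L by rewrite /L; lra.
have ln_le z : 0 < z -> ln z <= ln L + z / L - 1.
  move=> z0; have zL : 0 < z / L by apply: Rdiv_lt_0_compat.
  have -> : ln z = ln L + ln (z / L).
    by rewrite -ln_mult //; congr ln; field; apply: Rgt_not_eq.
  have := exp_ineq1_le (ln (z / L)); rewrite exp_ln //; lra.
have h1 := ln_le _ t0; have h2 := ln_le 1 Rlt_0_1; rewrite ln_1 in h2.
have e : a * (t / L) + (1 - a) * (1 / L) = 1.
  by rewrite /L; field; apply: Rgt_not_eq.
rewrite -(exp_ln L) // /Rpower.
have : a * ln t <= ln L by nra.
case=> [h|->]; [left; exact: exp_increasing | right; done].
Qed.

(** Bernoulli at [/ p] gives [1 - p ^ (- a) >= a * (1 - / p)]. *)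
Lemma geom_ratio_le (p a : R) : 1 < p -> 0 < a < 1 ->
  (1 - / p) / (1 - Rpower p (- a)) <= / a.
Proof.
move=> p1 a01; have p0 : 0 < p by lra.
have := Rpower_Bernoulli (Rinv_0_lt_compat _ p0) a01.
have -> : Rpower (/ p) a = Rpower p (- a).
  by rewrite /Rpower ln_Rinv //; congr exp; ring.
have ip1 : / p < 1 by rewrite -Rinv_1; apply: Rinv_lt_contravar; lra.
set P := Rpower _ _ => hP.
have P1 : 0 < 1 - P by nra.
have ae : a * / a = 1 by apply: Rinv_r; lra.
have ia0 : 0 < / a by apply: Rinv_0_lt_compat; lra.
apply: (Rmult_le_reg_r (1 - P)) => //.
have -> : (1 - / p) / (1 - P) * (1 - P) = 1 - / p by field; lra.
nra.
Qed.

Lemma nb_tail_large (mu r : nat) (p th : R) : 1 <= p ->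
  INR mu <= Rpower p (1 - th) -> Rpower p th ^ r * nb_tail (/ p) mu r <= 1.
Proof.
move=> p1 hmu; have p0 : 0 < p by lra.
have ip1 : / p <= 1 by rewrite -Rinv_1; apply: Rinv_le_contravar; lra.
have ip0 : 0 < / p by apply: Rinv_0_lt_compat.
have ip01 : (0 <= / p <= 1)%R by apply/andP; split; apply/RleP => //; left.
have /RleP := nb_tail_union mu r ip01.
rewrite -RpowE -INRE -RmultE => h.
apply: Rle_trans (Rmult_le_compat_l _ _ _ _ h) _.
  by apply: pow_le; left; apply: Rpower_gt0.
rewrite -Rpow_mult_distr -(pow1 r); apply: pow_incr; split.
  apply: Rmult_le_pos; first by left; apply: Rpower_gt0.
  by apply: Rmult_le_pos (pos_INR _) _; left; apply: Rinv_0_lt_compat.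
apply: (Rle_trans _ (Rpower p th * (Rpower p (1 - th) * / p))).
  apply: Rmult_le_compat_l; first by left; apply: Rpower_gt0.
  apply: Rmult_le_compat_r => //; left; exact: Rinv_0_lt_compat.
rewrite -Rmult_assoc -Rpower_plus (_ : th + (1 - th) = 1); last by ring.
by rewrite Rpower_1 // Rinv_r; [right | lra].
Qed.

Lemma nb_tail_small (mu r : nat) (p th K : R) : 1 < p -> 0 <= th < 1 ->
  (1 - / p) / (1 - Rpower p (- (1 - th))) <= K ->
  Rpower p th ^ r * nb_tail (/ p) mu r <= K ^ mu.
Proof.
move=> p1 th01 hK; have p0 : 0 < p by lra.
have ip1 : / p < 1 by rewrite -Rinv_1; apply: Rinv_lt_contravar; lra.
have ip0 : 0 < / p by apply: Rinv_0_lt_compat.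
have ip01 : (0 <= / p <= 1)%R by apply/andP; split; apply/RleP; left.
have z1 : 1 <= Rpower p th.
  by rewrite -(Rpower_O p p0); apply: Rle_Rpower; lra.
have xz : / p * Rpower p th = Rpower p (- (1 - th)).
  rewrite -{1}(Rpower_1 p) // -Rpower_Ropp -Rpower_plus; congr Rpower; ring.
have xz1 : Rpower p (- (1 - th)) < 1.
  by have := Rpower_lt p (- (1 - th)) 0 p1; rewrite Rpower_O //; apply; lra.
have : (1 <= Rpower p th :> R)%R by apply/RleP.
move=> /(nb_tail_chernoff mu r ip01); rewrite -RmultE xz.
move=> /(_ (introT RltP xz1))/RleP.
rewrite -!RpowE => h; apply: Rle_trans h _.
change (((1 - / p) / (1 - Rpower p (- (1 - th)))) ^ mu <= K ^ mu).
apply: pow_incr; split=> //.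
apply: Rmult_le_pos; first by lra.
by left; apply: Rinv_0_lt_compat; lra.
Qed.

(** The loss allowed at [p]. Excluding [p = 0] leaves at most [y] indices with factor [K]. *)
Definition below (K y : R) (p : nat) : R :=
  if (0 < p)%N then (if Rlt_dec (INR p) y then K else 1) else 1.

Lemma below_ge1 (K y : R) (p : nat) : 1 <= K -> 1 <= below K y p.
Proof.
rewrite /below => K1; case: ifP => _; last lra.
by case: (Rlt_dec (INR p) y) => ? /=; lra.
Qed.

Lemma prod_below_le (K y : R) (M : nat) : 1 <= K -> 0 <= y ->
  (\prod_(p < M) below K y p)%R <= Rpower K y.
Proof.
move=> K1 y0; have K0 : 0 < K by lra.
have mono a b : a <= b -> Rpower K a <= Rpower K b.
  move=> ab; case: K1 => [K1|<-]; first by apply: Rle_Rpower; lra.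
  by rewrite /Rpower ln_1 !Rmult_0_r; right.
have Ky : 1 <= Rpower K y by rewrite -(Rpower_O K K0); apply: mono.
have [->|M0] := posnP M; first by rewrite big_ord0.
rewrite -(prednK M0).
(* The minimum makes the induction work: the exponent grows with the range until it reaches [y]. *)
suff : (\prod_(p < M.-1.+1) below K y p)%R <= Rpower K (Rmin y (INR M.-1)).
  by move=> h; apply: Rle_trans h (mono _ _ (Rmin_l _ _)).
elim: (M.-1) => [|n IHn].
  by rewrite big_ord1 /below /= Rmin_right // Rpower_O //; right.
rewrite big_ord_recr.
change ((\prod_(p < n.+1) below K y p)%R * below K y n.+1
  <= Rpower K (Rmin y (INR n.+1))).
have b0 := below_ge1 y n.+1 K1.
apply: Rle_trans (Rmult_le_compat_r _ _ _ _ IHn) _; first by lra.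
rewrite /below; change (0 < n.+1)%N with true; cbv iota.
have nS : INR n.+1 = INR n + 1 by rewrite S_INR.
case: (Rlt_dec (INR n.+1) y) => ny; rewrite /is_left.
  rewrite !Rmin_right; try lra.
  by rewrite nS Rpower_plus Rpower_1 //; right.
rewrite Rmult_1_r; apply: mono; apply: Rle_min_compat_l; lra.
Qed.

Lemma Rpower_prod (M : nat) (e : 'I_M -> nat) (th : R) :
  (forall p : 'I_M, (0 < p ^ e p)%N) ->
  Rpower (INR (\prod_(p < M) p ^ e p)%N) th =
    (\prod_(p < M) Rpower (INR (p ^ e p)%N) th)%R.
Proof.
move=> pos.
suff [_ ->] : (0 < \prod_(p < M) p ^ e p)%N /\
  Rpower (INR (\prod_(p < M) p ^ e p)%N) th =
  (\prod_(p < M) Rpower (INR (p ^ e p)%N) th)%R by [].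
apply: (big_ind2 (fun (n : nat) (x : R) => (0 < n)%N /\ Rpower (INR n) th = x)).
- by split; rewrite // /Rpower ln_1 Rmult_0_r exp_0.
- move=> n1 x1 n2 x2 [n10 <-] [n20 <-]; split; first by rewrite muln_gt0 n10.
  have -> : INR (n1 * n2)%N = INR n1 * INR n2 by exact: mult_INR.
  by rewrite -Rpower_mult_distr //; apply: lt_0_INR; apply/ssrnat.ltP.
- by move=> p _.
Qed.

Lemma Rpower_INR_expn (p r : nat) (th : R) : (0 < p)%N ->
  Rpower (INR (p ^ r)%N) th = Rpower (INR p) th ^ r.
Proof.
move=> p0; have p0' : 0 < INR p by apply: lt_0_INR; apply/ssrnat.ltP.
elim: r => [|r IHr]; first by rewrite expn0 /= /Rpower ln_1 Rmult_0_r exp_0.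
have -> : INR (p ^ r.+1)%N = INR p * INR (p ^ r)%N.
  by rewrite expnS; exact: mult_INR.
rewrite -Rpower_mult_distr ?IHr //.
by apply: lt_0_INR; apply/ssrnat.ltP; rewrite expn_gt0 p0.
Qed.

(** [N ^ th] splits over the prime powers of [N], so factors compare one by one; [1 <= C p] covers
    the [p] with [logn p N = 0]. *)
Lemma nb_bound_le (M mu N : nat) (th : R) (C : nat -> R) :
  (0 < N < M)%N ->
  (forall p, 1 <= C p) ->
  (forall p r, (1 < p)%N -> Rpower (INR p) th ^ r * nb_tail (/ INR p) mu r <= C p) ->
  Rpower (INR N) th * nb_bound R M mu N <= (\prod_(p < M) C p)%R.
Proof.
move=> NM C1 hC; have [N0 _] := andP NM.
have pos (p : 'I_M) : (0 < p ^ logn p N)%N.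
  have [e|] := posnP (logn p N); first by rewrite e.
  by rewrite logn_gt0 mem_primes expn_gt0 => /andP[/prime_gt0 ->].
rewrite -{1}(prod_logn NM) Rpower_prod // /nb_bound RmultE -big_split.
apply/RleP/ler_prod => p _; apply/andP; split.
  apply: mulr_ge0; last by apply: nb_tail_ge0; apply: natr_inv_itv.
  by apply/RleP; left; apply: Rpower_gt0.
apply/RleP; rewrite -INRE.
change (Rpower (INR (p ^ logn p N)%N) th * nb_tail (/ INR p) mu (logn p N) <= C p).
have [e|] := posnP (logn p N).
  by rewrite e nb_tail0 expn0 /Rpower ln_1 Rmult_0_r exp_0 Rmult_1_l; apply: C1.
rewrite logn_gt0 mem_primes => /andP[/prime_gt1 p1 _].
by rewrite Rpower_INR_expn ?(ltnW p1) //; apply: hC.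
Qed.

(** * Logarithm estimates and the total loss *)

Lemma ln2_lt1 : ln 2 < 1.
Proof.
rewrite -[X in _ < X](ln_exp 1); apply: ln_increasing; first lra.
by have := exp_ineq1 1 R1_neq_R0; lra.
Qed.

Lemma ln_le_tangent (w c : R) : 0 < w -> 0 < c -> ln w <= w / c - 1 + ln c.
Proof.
move=> w0 c0; have wc : 0 < w / c by apply: Rdiv_lt_0_compat.
have -> : ln w = ln (w / c) + ln c.
  by rewrite -ln_mult //; congr ln; field; lra.
by have := exp_ineq1_le (ln (w / c)); rewrite exp_ln //; lra.
Qed.

(* Tangents of [ln] at 1, 2 and 8 = 2 ^ 3 suffice on [1, 2], [2, 4] and [4, 8]. *)
Lemma ln_1p_small (eps : R) : 0 < eps <= 7 ->
  ln (1 + eps) <= 4 * (eps / (1 + eps)) * ln 2.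
Proof.
move=> [e0 e7]; set w := 1 + eps.
have w1 : 1 < w by rewrite /w; lra.
have l2 := ln_lt_2; have h := ln_le_tangent (w := w).
have ew : eps / w = 1 - / w by rewrite /w; field; lra.
have iw : w * / w = 1 by apply: Rinv_r; lra.
have iw0 : 0 < / w by apply: Rinv_0_lt_compat; lra.
rewrite ew.
have [w2|w2] := Rle_or_lt w 2.
  have := h 1 ltac:(lra) ltac:(lra); rewrite ln_1 Rdiv_1_r => h1.
  apply: Rle_trans h1 _.
  have -> : w - 1 + 0 = w * (1 - / w) by rewrite Rmult_minus_distr_l iw; ring.
  have : 0 < 1 - / w by nra.
  nra.
have [w4|w4] := Rle_or_lt w 4.
  have h1 := h 2 ltac:(lra) ltac:(lra).
  have a1 : / w <= / 2 by apply: Rinv_le_contravar; lra.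
  (* As [ln 2 > 1 / 2], it is enough that [w + 4 / w <= 5], which is the sign of this product. *)
  have a2 : 0 <= (w - 1) * (4 - w) * / w by nra.
  have a3 : (w - 1) * (4 - w) * / w = 5 - w - 4 * / w.
    by field; lra.
  nra.
have h1 := h 8 ltac:(lra) ltac:(lra).
have l8 : ln 8 = 3 * ln 2.
  have -> : 8 = 2 ^ 3 by ring.
  by rewrite ln_pow /=; [ring | lra].
have a1 : / w <= / 4 by apply: Rinv_le_contravar; lra.
have w8 : w <= 8 by rewrite /w; lra.
rewrite l8 in h1.
nra.
Qed.

(** Compares the tangent of [ln] at [8] with [2 ^ (w / 2) >= 1 + w / 4], where [w = 1 + eps]. *)
Lemma ln_1p_large (u eps : R) : 2 <= u -> 7 < eps ->
  ln (1 + eps) <= 3 / 2 * ln 2 * Rpower u ((1 + eps) / 2).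
Proof.
move=> u2 e7; have l2 := ln_lt_2; have l2' := ln2_lt1.
have h1 := ln_le_tangent (w := 1 + eps) (c := 8) ltac:(lra) ltac:(lra).
have l8 : ln 8 = 3 * ln 2.
  have -> : 8 = 2 ^ 3 by ring.
  by rewrite ln_pow /=; [ring | lra].
have h2 : 1 + (1 + eps) / 4 <= Rpower u ((1 + eps) / 2).
  apply: (Rle_trans _ (Rpower 2 ((1 + eps) / 2))).
    apply: Rle_trans (exp_ineq1_le _); nra.
  by apply: Rle_Rpower_l; lra.
rewrite l8 in h1; nra.
Qed.

(** The threshold is where [mu = p ^ (1 - th)]: Chernoff below it, the union bound from there on. *)
Lemma nb_tail_loss (p mu r : nat) (th K : R) : (1 < p)%N -> 0 < th < 1 ->
  (INR p < Rpower (INR mu) (/ (1 - th)) ->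
    (1 - / INR p) / (1 - Rpower (INR p) (- (1 - th))) <= K) ->
  (0 < mu)%N ->
  Rpower (INR p) th ^ r * nb_tail (/ INR p) mu r
    <= if Rlt_dec (INR p) (Rpower (INR mu) (/ (1 - th))) then K ^ mu else 1.
Proof.
move=> p1 th01 hK mu0.
have p1' : 1 < INR p by apply: (lt_INR 1); apply/ssrnat.ltP.
have mu0' : 0 < INR mu by apply: lt_0_INR; apply/ssrnat.ltP.
case: Rlt_dec => hp /=; first by apply: nb_tail_small; [| lra | apply: hK].
apply: nb_tail_large; first lra.
have {1}-> : INR mu = Rpower (Rpower (INR mu) (/ (1 - th))) (1 - th).
  by rewrite Rpower_mult Rinv_l ?Rpower_1 //; lra.
by apply: Rle_Rpower_l; [lra | split; [apply: Rpower_gt0 | lra]].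
Qed.

Lemma Rpower_pow_exp (K y : R) (n : nat) :
  0 < K -> Rpower (K ^ n) y = exp (y * (INR n * ln K)).
Proof. by move=> K0; rewrite /Rpower ln_pow. Qed.

(* From [u ^ ((1 + eps) / 2)] on, [p ^ (1 / (1 + eps)) >= sqrt u >= 4 / 3]. *)
Lemma geom_ratio_le4 (p u w : R) : 2 <= u -> 1 < p -> 0 < w ->
  Rpower u (w / 2) <= p -> (1 - / p) / (1 - Rpower p (- / w)) <= 4.
Proof.
move=> u2 p1 w0 sp.
have iw0 : 0 < / w by apply: Rinv_0_lt_compat.
have ip0 : 0 < / p by apply: Rinv_0_lt_compat; lra.
set Q := Rpower p (/ w).
have Q2 : 2 <= Q * Q.
  rewrite /Q -Rpower_plus.
  apply: (Rle_trans _ (Rpower (Rpower u (w / 2)) (/ w + / w))).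
    rewrite Rpower_mult (_ : w / 2 * (/ w + / w) = 1); last by field; lra.
    by rewrite Rpower_1; lra.
  by apply: Rle_Rpower_l; [lra | split; [apply: Rpower_gt0 | ]].
have Q0 : 0 < Q by apply: Rpower_gt0.
have Q43 : 4 / 3 <= Q by nra.
have P34 : Rpower p (- / w) <= 3 / 4.
  rewrite Rpower_Ropp -/Q (_ : 3 / 4 = / (4 / 3)); last by field.
  by apply: Rinv_le_contravar; lra.
apply: (Rmult_le_reg_r (1 - Rpower p (- / w))); first lra.
rewrite (_ : (1 - / p) / _ * _ = 1 - / p); first lra.
by field; lra.
Qed.

(** At most [mu ^ (1 + eps)] indices lose anything, each a [mu]-th power, whence the exponent
    [mu ^ (2 + eps)]. *)
Lemma nb_bound_Rpower_le (M mu N : nat) (eps : R) :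
  (2 <= mu)%N -> 0 < eps -> (0 < N < M)%N ->
  Rpower (INR N) (eps / (1 + eps)) * nb_bound R M mu N <=
    Rpower 2 (4 * (eps / (1 + eps)) * Rpower (INR mu) (2 + eps)).
Proof.
move=> mu2 e0 NM; set u := INR mu; set w := 1 + eps; set th := eps / w.
have u2 : 2 <= u by apply: (le_INR 2); apply/ssrnat.leP.
have w0 : 0 < w by rewrite /w; lra.
have thE : 1 - th = / w by rewrite /th /w; field; lra.
have iw0 : 0 < / w by apply: Rinv_0_lt_compat.
have th0 : 0 < th by rewrite /th; apply: Rdiv_lt_0_compat.
have iw1 : / w < 1 by lra.
have mu0 : (0 < mu)%N by apply: leq_trans mu2.
set Y := Rpower u w.
have Y0 : 0 < Y by apply: Rpower_gt0.
have YE : Rpower u (2 + eps) = u * Y.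
  have -> : 2 + eps = 1 + w by rewrite /w; ring.
  by rewrite Rpower_plus Rpower_1 //; lra.
have l2 := ln_lt_2.
have p1 p : (1 < p)%N -> 1 < INR p.
  by move=> p1; apply: (lt_INR 1); apply/ssrnat.ltP.
have ratio_w p : (1 < p)%N -> (1 - / INR p) / (1 - Rpower (INR p) (- (1 - th))) <= w.
  move=> hp; rewrite thE -[X in _ <= X]Rinv_inv.
  by apply: geom_ratio_le; [apply: p1 | lra].
have th01 : 0 < th < 1 by lra.
have YthE : Rpower u (/ (1 - th)) = Y by rewrite thE Rinv_inv.
have pow_ge1 (K : R) : 1 <= K -> 1 <= K ^ mu by apply: pow_R1_Rle.
(* Bounding every loss by [w ^ mu] is too weak for large [eps]; it is then kept
   only for [p < s = sqrt Y], and the loss is at most [4 ^ mu] beyond. *)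
have [e7|e7] := Rle_or_lt eps 7.
  apply: (Rle_trans _ (Rpower (w ^ mu) Y)).
    have hw : 1 <= w ^ mu by apply: pow_ge1; rewrite /w; lra.
    apply: Rle_trans (prod_below_le M hw (Rlt_le _ _ Y0)).
    apply: nb_bound_le => // [p|p r hp]; first exact: below_ge1.
    rewrite /below (ltnW hp) -YthE.
    by apply: nb_tail_loss => // _; apply: ratio_w.
  rewrite Rpower_pow_exp // YE; apply: exp_le_compat.
  have := ln_1p_small (conj e0 e7); rewrite -/w -/th -/u => h.
  have uY : 0 < u * Y by nra.
  nra.
set s := Rpower u (w / 2).
have s0 : 0 < s by apply: Rpower_gt0.
have sY : s * s = Y by rewrite -Rpower_plus; congr Rpower; field.
apply: (Rle_trans _ (Rpower (4 ^ mu) Y * Rpower (w ^ mu) s)).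
  have hw : 1 <= w ^ mu by apply: pow_ge1; rewrite /w; lra.
  have h4 : 1 <= 4 ^ mu by apply: pow_ge1; lra.
  apply: (Rle_trans _ (\prod_(p < M) (below (4 ^ mu) Y p * below (w ^ mu) s p))%R).
    apply: (@nb_bound_le M mu N th
      (fun p => below (4 ^ mu) Y p * below (w ^ mu) s p)) => // [p|p r hp].
      have := below_ge1 Y p h4; have := below_ge1 s p hw.
      set b1 := below _ _ _; set b2 := below _ _ _ => b1_ge b2_ge.
      by change (1 <= b2 * b1); nra.
    change (Rpower (INR p) th ^ r * nb_tail (/ INR p) mu r <=
      below (4 ^ mu) Y p * below (w ^ mu) s p).
    have b4 := below_ge1 Y p h4.
    rewrite {2}/below (ltnW hp); case: Rlt_dec => ps /=.
      have := nb_tail_loss r hp th01 (fun _ => ratio_w p hp) mu0.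
      by case: Rlt_dec => ? /= h; apply: Rle_trans h _; nra.
    rewrite Rmult_1_r /below (ltnW hp) -YthE.
    apply: nb_tail_loss => // _; rewrite thE.
    by apply: (geom_ratio_le4 u2 (p1 _ hp) w0); rewrite -/s; lra.
  rewrite big_split.
  change ((\prod_(p < M) below (4 ^ mu) Y p)%R * (\prod_(p < M) below (w ^ mu) s p)%R
    <= Rpower (4 ^ mu) Y * Rpower (w ^ mu) s).
  have prod_ge0 K y : 1 <= K -> 0 <= (\prod_(p < M) below K y p)%R.
    move=> K1; apply/RleP/prodr_ge0 => p _; apply/RleP.
    exact: Rle_trans Rle_0_1 (below_ge1 y p K1).
  apply: Rmult_le_compat; try exact: prod_ge0.
    by apply: prod_below_le => //; lra.
  by apply: prod_below_le => //; lra.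
rewrite !Rpower_pow_exp //; last lra.
rewrite -exp_plus YE; apply: exp_le_compat.
have l4 : ln 4 = 2 * ln 2.
  have -> : 4 = 2 ^ 2 by ring.
  by rewrite ln_pow /=; [ring | lra].
have h := ln_1p_large u2 e7; rewrite -/w -/s in h.
(* Hence [4 * th >= 7 / 2]; the factors [4 ^ mu] use up [2] of this, and the remaining [3 / 2] is
   the constant of [ln_1p_large]. *)
have th78 : 7 / 8 <= th.
  have -> : th = 1 - / w by lra.
  have : / w <= / 8 by apply: Rinv_le_contravar; rewrite /w; lra.
  lra.
rewrite l4 -/u -sY.
have h' := Rmult_le_compat_l _ _ _ (Rlt_le _ _ s0) h.
have ss : 0 < ln 2 * (s * s) by nra.
have q78 := Rmult_le_compat_r _ _ _ (Rlt_le _ _ ss) th78.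
have : u * (s * s * (2 * ln 2) + s * ln w) <= u * (4 * th * (s * s) * ln 2).
  by apply: Rmult_le_compat_l; lra.
lra.
Qed.

Theorem theorem2 (mu lambda : nat) (eps : R) (N : nat) :
  (2 <= mu)%N -> (1 <= lambda)%N ->
  logb (INR mu) 2 <= eps ->
  (0 < N)%N ->
  logb 2 (INR N) >= 4 * Rpower (INR mu) (2 + eps) + (1 + / eps) * INR lambda ->
  forall (m : nat) (f : {mpoly int[mu]}),
    (0 < m)%N -> multilinear f -> coprime_to f N ->
    zero_prob m N f <= / (2 ^ lambda) + INR mu / INR m.
Proof.
move=> mu2 _ heps N0 hN m f m0 ml cop.
have NM : (0 < N < N.+1)%N by rewrite N0 ltnSn.
apply: Rle_trans (zero_prob_le m0 NM ml cop) (Rplus_le_compat_r _ _ _ _).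
have u2 : 2 <= INR mu by apply: (le_INR 2); apply/ssrnat.leP.
have l2 := ln_lt_2.
have e0 : 0 < eps.
  apply: (Rlt_le_trans _ _ _ _ heps); apply: Rdiv_lt_0_compat; first lra.
  by rewrite -ln_1; apply: ln_increasing; lra.
set th := eps / (1 + eps).
have th0 : 0 < th by apply: Rdiv_lt_0_compat; lra.
(* After multiplication by [th], the bound on [ln N] yields exactly [lambda * ln 2] plus the
   exponent lost in [hB]. *)
have the : th * (1 + / eps) = 1 by rewrite /th; field; lra.
have := nb_bound_Rpower_le mu2 e0 NM; rewrite -/th.
set B := nb_bound _ _ _ _; set X := Rpower (INR mu) (2 + eps) in hN *.
move=> hB.
have lnN : (4 * X + (1 + / eps) * INR lambda) * ln 2 <= ln (INR N).
  have -> : ln (INR N) = logb 2 (INR N) * ln 2 by rewrite /logb; field; lra.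
  by apply: Rmult_le_compat_r; [lra | apply: Rge_le].
have -> : / 2 ^ lambda = Rpower 2 (- INR lambda).
  by rewrite Rpower_Ropp Rpower_pow //; lra.
apply: (Rmult_le_reg_l (Rpower (INR N) th)); first exact: Rpower_gt0.
apply: Rle_trans hB _; rewrite /Rpower -exp_plus; apply: exp_le_compat.
have : th * ((4 * X + (1 + / eps) * INR lambda) * ln 2) <= th * ln (INR N).
  by apply: Rmult_le_compat_l; lra.
have -> : th * ((4 * X + (1 + / eps) * INR lambda) * ln 2) =
  4 * th * X * ln 2 + (th * (1 + / eps)) * INR lambda * ln 2 by ring.
by rewrite the; lra.
Qed.
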